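(* Let $\mathbb{T}$ be a coherent theory with spectral groupoid $\mathcal{M}=\mathrm{Spec}(\mathbb{T})$ and let $x:A$ be a context. If $S\subseteq[\![A]\!]$ is an equivariant subsheaf, then $S$ is a union of definable subsheaves, i.e. there is a set of coherent formulas $\{\varphi_i(x)\}_{i\in I}$ with $S=\bigcup_{i\in I}[\![\varphi_i]\!]$.
   Context: $\mathcal{L}$ is a multi-sorted first-order language with set of basic sorts $\mathcal{A}$. Coherent formulas are built from atomic formulas using $\top,\bot,=,\wedge,\vee,\exists$, always in a fixed finite context $x=\langle x_1:A_1,\dots,x_n:A_n\rangle$ (abbreviated $x:A$). A coherent theory $\mathbb{T}$ is a set of sequents $\varphi(x)\vdash_{x}\psi(x)$ of coherent formulas; a structure $M$ satisfies the sequent if $\varphi^M\subseteq\psi^M\subseteq |M|^x:=A_1^M\times\dots\times A_n^M$ (sorts may be empty). Fix $\kappa=|\mathcal{L}|+\aleph_0$. Labelled models: a point $\mu$ of $\mathcal{M}_0$ is a $\mathbb{T}$-model $M_\mu$ together with, for each basic sort $A$, a subset $K^A_\mu\subseteq\kappa$ and a function $v^A_\mu:K^A_\mu\to A^{M_\mu}$ all of whose fibres are infinite. For a context $x=\langle x_i:A_i\rangle$ and $k\in\kappa^n$, $k$ is defined at $\mu$ if $k_i\in K_\mu^{A_i}$ for all $i$, and then $\mu(k)=(v_\mu^{A_i}(k_i))_i\in|M_\mu|^x$. The topology on $\mathcal{M}_0$ has as basis the sets $V_{\varphi(k)}=\{\mu: k \text{ is defined at }\mu \text{ and } M_\mu\models\varphi(\mu(k))\}$,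 for $\varphi(x)$ coherent and $k\in\kappa^n$. Groupoid: $\mathcal{M}_1$ is the set of model isomorphisms $\alpha:M_\mu\cong M_\nu$ (no compatibility with labellings), with topology generated by the sets $\mathrm{dom}^{-1}(V_{\varphi(k)})$, $\mathrm{cod}^{-1}(V_{\varphi(k)})$ and $V_{k\mapsto l}=\{\alpha:\mu\to\nu\mid k,l\text{ defined at }\mu,\nu\text{ resp.},\ \alpha(\mu(k))=\nu(l)\}$ for $k,l$ in the same context. Equivariant sheaves: an equivariant sheaf is an étale space $F\to\mathcal{M}_0$ with a continuous action $\rho:\mathcal{M}_1\times_{\mathrm{dom},\mathcal{M}_0}F\to F$ over $\mathrm{cod}$, $\rho_\alpha:F_\mu\to F_\nu$, with $\rho_{1_\mu}=\mathrm{id}$ and $\rho_{\alpha\circ\beta}=\rho_\alpha\circ\rho_\beta$. An equivariant subsheaf is a subsheaf (open subset) stable under $\rho$. $[\![A]\!]$ is the set of pairs $\langle\mu,a\rangle$ with $\mu\in\mathcal{M}_0$, $a\in|M_\mu|^x$, with basic open sets $W_{\varphi(x,l)}=\{\langle\mu,a\rangle: l\text{ is defined at }\mu,\ M_\mu\models\varphi(a,\mu(l))\}$ ($\varphi(x,y)$ coherent, $l$ a parameter sequence for $y$). It is an equivariant sheaf via $\rho_\alpha(\langle\mu,a\rangle)=\langle\nu,\alpha(a)\rangle$. For a coherent formula $\varphi(x)$, the definable subsheaf is $[\![\varphi]\!]=\{\langle\mu,a\rangle: M_\mu\models\varphi(a)\}$. *)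

(* Defs.v *)
From HB Require Import structures.
From mathcomp Require Import all_boot all_classical topology.

Set Implicit Arguments.
Unset Strict Implicit.
Unset Printing Implicit Defensive.

Local Open Scope classical_set_scope.
Local Open Scope card_scope.

(* A context <x_1 : A_1, ..., x_n : A_n> is the list of sorts [:: A_1; ...; A_n];
   [var x A] is the type of positions of sort A in x. *)
Inductive var (S : Type) : seq S -> S -> Type :=
| vz A G : var (A :: G) A
| vs A B G : var G A -> var (B :: G) A.
Arguments vz {S A G}.
Arguments vs {S A B G} v.

(* [tuple_over F x] is the product F A_1 * ... * F A_n. *)
Definition tuple_over (S : Type) (F : S -> Type) (x : seq S) : Type :=
  forall A, var x A -> F A.

Definition var_nil S (A : S) (v : var [::] A) : void :=
  match v in var x _ return if x is [::] then void else unit with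
  | vz _ _ => tt
  | vs _ _ _ _ => tt
  end.

Definition tnil S (F : S -> Type) : tuple_over F [::] :=
  fun A v => of_void (F A) (var_nil v).

Definition tcons S (F : S -> Type) B x (b : F B) (a : tuple_over F x) :
    tuple_over F (B :: x) :=
  fun A v =>
    match v in var x' A'
          return (if x' is B' :: x'' then F B' -> tuple_over F x'' -> F A'
                  else unit) with
    | vz _ _ => fun b _ => b
    | vs _ _ _ w => fun _ a => a _ w
    end b a.

Fixpoint tcat S (F : S -> Type) x y :
    tuple_over F x -> tuple_over F y -> tuple_over F (x ++ y) :=
  match x return tuple_over F x -> tuple_over F y -> tuple_over F (x ++ y) with
  | [::] => fun _ b => b
  | B :: x' => fun a b => tcons (a _ vz) (tcat (fun A v => a A (vs v)) b)
  end.

Definition tmap S (F F' : S -> Type) (f : forall A, F A -> F' A) x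
    (a : tuple_over F x) : tuple_over F' x := fun A v => f A (a A v).

Fixpoint vinl S (x y : seq S) A (v : var x A) : var (x ++ y) A :=
  match v in var x' A' return var (x' ++ y) A' with
  | vz _ _ => vz
  | vs _ _ _ w => vs (vinl y w)
  end.

Fixpoint vinr S (x y : seq S) A (v : var y A) : var (x ++ y) A :=
  if x is B :: x' then vs (vinr x' v) else v.

Record language := Language {
  sort : Type;
  fsym : Type;
  rsym : Type;
  fdom : fsym -> seq sort;
  fcod : fsym -> sort;
  rdom : rsym -> seq sort
}.

Definition context (L : language) := seq (sort L).

Definition symbol (L : language) : Type := (sort L + (fsym L + rsym L))%type.

(* K is a set of labels of cardinality |L| + aleph_0; nothing else about the
   cardinal is used by the labellings below. *)
Definition has_card_kappa (L : language) (K : Type) : Prop :=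
  [set: K] #= [set: nat + symbol L].

Inductive term (L : language) (x : context L) : sort L -> Type :=
| tvar A : var x A -> term x A
| tapp f : (forall A, var (fdom f) A -> term x A) -> term x (fcod f).

(* Formulas in context; [fex B phi] binds the first variable of B :: x. *)
Inductive formula (L : language) : context L -> Type :=
| ftrue x : formula x
| ffalse x : formula x
| frel x r : tuple_over (@term L x) (rdom r) -> formula x
| feq x A : term x A -> term x A -> formula x
| fand x : formula x -> formula x -> formula x
| for_ x : formula x -> formula x -> formula x
| fex x B : formula (B :: x) -> formula x.
Arguments ftrue {L x}.
Arguments ffalse {L x}.

Record sequent (L : language) := Sequent {
  seq_ctx : context L;
  seq_lhs : formula seq_ctx;
  seq_rhs : formula seq_ctx
}.

Definition theory (L : language) := set (sequent L).

Record structure (L : language) := Structure {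
  carrier : sort L -> Type;
  fint : forall f : fsym L, tuple_over carrier (fdom f) -> carrier (fcod f);
  rint : forall r : rsym L, set (tuple_over carrier (rdom r))
}.

(* |M|^x *)
Definition points L (M : structure L) (x : context L) : Type :=
  tuple_over (carrier M) x.

Fixpoint teval L (M : structure L) x (a : points M x) A (t : term x A) :
    carrier M A :=
  match t in term _ A return carrier M A with
  | tvar _ v => a _ v
  | tapp f s => fint (fun B v => teval a (s B v))
  end.

Fixpoint sat L (M : structure L) x (phi : formula x) : points M x -> Prop :=
  match phi in formula x return points M x -> Prop with
  | ftrue _ => fun _ => True
  | ffalse _ => fun _ => False
  | frel _ r s => fun a => rint (tmap (fun A => @teval L M _ a A) s)
  | feq _ _ s t => fun a => teval a s = teval a t
  | fand _ phi psi => fun a => sat phi a /\ sat psi a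
  | for_ _ phi psi => fun a => sat phi a \/ sat psi a
  | fex _ B phi => fun a => exists b : carrier M B, sat phi (tcons b a)
  end.

Definition extension L (M : structure L) x (phi : formula x) :
  set (points M x) := [set a | sat phi a].

Arguments extension {L} M {x} phi.

Definition satisfies L (M : structure L) (s : sequent L) : Prop :=
  extension M (seq_lhs s) `<=` extension M (seq_rhs s).

Record model L (T : theory L) := Model {
  model_str :> structure L;
  model_sat : forall s, T s -> satisfies model_str s
}.

Record iso L (M N : structure L) := Iso {
  iso_fun :> forall A, carrier M A -> carrier N A;
  iso_bij : forall A, bijective (@iso_fun A);
  iso_fint : forall f (a : points M (fdom f)),
    iso_fun (fint a) = fint (tmap (@iso_fun) a);
  iso_rint : forall r (a : points M (rdom r)),
    rint a <-> rint (tmap (@iso_fun) a)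
}.

Arguments iso_fun {L M N} i A.
Arguments iso_bij {L M N} i A.

Program Definition iso_id L (M : structure L) : iso M M :=
  @Iso L M M (fun _ a => a) _ _ _.
Next Obligation. by move=> L M A; exists id. Qed.
Next Obligation. by []. Qed.
Next Obligation. by []. Qed.

Program Definition iso_comp L (M N P : structure L) (i : iso N P) (j : iso M N) :
    iso M P :=
  @Iso L M P (fun A a => i A (j A a)) _ _ _.
Next Obligation.
by move=> L M N P i j A; apply: bij_comp; apply: iso_bij.
Qed.
Next Obligation. by move=> L M N P i j f a /=; rewrite (iso_fint j) (iso_fint i). Qed.
Next Obligation.
by move=> L M N P i j r a /=; rewrite (iso_rint j) (iso_rint i).
Qed.

(* A partial function [lab] encodes the subset K^A of K (where it is defined)
   together with v^A : K^A -> A^M.  Fibres are taken over all elements of A^M,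
   so v^A is surjective. *)
Record labelled_model L (T : theory L) (K : Type) := LabelledModel {
  lm_model :> model T;
  lab : forall A, K -> option (carrier lm_model A);
  lab_infinite : forall A (a : carrier lm_model A),
    infinite_set [set k | lab A k = Some a]
}.

Arguments lab {L T K} l A k.
Arguments lab_infinite {L T K} l {A} a _.

Definition params (L : language) (K : Type) (x : context L) : Type :=
  tuple_over (fun _ : sort L => K) x.

(* k is defined at mu, and mu(k) = a *)
Definition labels_at L (T : theory L) K (mu : labelled_model T K)
    x (k : params K x) (a : points mu x) : Prop :=
  forall A (v : var x A), lab mu A (k A v) = Some (a A v).

Arguments labels_at {L T K} mu {x} k a.

(* V_{phi(k)} *)
Definition spec_basic L (T : theory L) K (x : context L) (phi : formula x)
    (k : params K x) :
    set (labelled_model T K) :=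
  [set mu : labelled_model T K | exists2 a : points mu x, labels_at mu k a & sat phi a].

Definition spec_base L (T : theory L) K : set_system (labelled_model T K) :=
  [set U | exists (x : context L) (phi : formula x) (k : params K x), U = spec_basic phi k].

Record arrow L (T : theory L) (K : Type) := Arrow {
  dom : labelled_model T K;
  cod : labelled_model T K;
  arr :> iso dom cod
}.

Definition arrow_id L (T : theory L) K (mu : labelled_model T K) : arrow T K :=
  Arrow (iso_id mu).

(* V_{k |-> l} *)
Definition arrow_basic L (T : theory L) K (x : context L) (k l : params K x) :
    set (arrow T K) :=
  [set al : arrow T K | exists (a : points (dom al) x) (b : points (cod al) x),
     [/\ labels_at (dom al) k a, labels_at (cod al) l b & tmap al a = b]].

Definition arrow_subbase L (T : theory L) K : set_system (arrow T K) :=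
  [set U |
    [\/ exists (x : context L) (phi : formula x) (k : params K x),
          U = @dom L T K @^-1` spec_basic phi k,
        exists (x : context L) (phi : formula x) (k : params K x),
          U = @cod L T K @^-1` spec_basic phi k
      | exists (x : context L) (k l : params K x), U = arrow_basic k l]].

Section Substitution.
Context (L : language).
Implicit Types (x y : context L) (M : structure L).

Definition renaming x y := tuple_over (var y) x.

Definition rlift x y B (r : renaming x y) : renaming (B :: x) (B :: y) :=
  tcons vz (fun A v => vs (r A v)).

Fixpoint trename x y (r : renaming x y) A (t : term x A) : term y A :=
  match t in term _ A return term y A with
  | tvar _ v => tvar (r _ v)
  | tapp f s => tapp (fun B v => trename r (s B v))
  end.

Fixpoint frename x (phi : formula x) : forall y, renaming x y -> formula y :=
  match phi in formula x return forall y, renaming x y -> formula y with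
  | ftrue _ => fun _ _ => ftrue
  | ffalse _ => fun _ _ => ffalse
  | frel _ r s => fun y rho => frel (fun A v => trename rho (s A v))
  | feq _ _ s t => fun y rho => feq (trename rho s) (trename rho t)
  | fand _ phi psi => fun y rho => fand (frename phi rho) (frename psi rho)
  | for_ _ phi psi => fun y rho => for_ (frename phi rho) (frename psi rho)
  | fex _ B phi => fun y rho => fex (frename phi (rlift (B := B) rho))
  end.

Lemma tuple_ext (F : sort L -> Type) x (a b : tuple_over F x) :
  (forall A v, a A v = b A v) -> a = b.
Proof.
by move=> ab; apply: functional_extensionality_dep => A;
   apply: functional_extensionality_dep => v.
Qed.

Lemma var_consP B x (P : forall A, var (B :: x) A -> Prop) :
  P B vz -> (forall A v, P A (vs v)) -> forall A v, P A v.
Proof.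
move=> Pz Ps A v.
by refine (match v in var x' A'
  return match x' return var x' A' -> Prop with
         | [::] => fun _ => True
         | B' :: x'' => fun v => forall P : forall A, var (B' :: x'') A -> Prop,
             P B' vz -> (forall A v, P A (vs v)) -> P A' v
         end v with vz _ _ => _ | vs _ _ _ _ => _ end P Pz Ps) => //.
Qed.

Lemma teval_rename M x y (r : renaming x y) (a : points M y) A (t : term x A) :
  teval a (trename r t) = teval (fun B v => a B (r B v)) t.
Proof.
elim: t => [B v|f s IH] //=.
by congr fint; apply: tuple_ext => B v; apply: IH.
Qed.

Lemma sat_rename M x (phi : formula x) y (r : renaming x y) (a : points M y) :
  sat (frename phi r) a <-> sat phi (fun B v => a B (r B v)).
Proof.
elim: phi y r a => {x}
  [x|x|x R s|x A s t|x p IHp q IHq|x p IHp q IHq|x B p IHp] y r a //=.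
- suff -> : tmap (fun A => @teval L M y a A) (fun A v => trename r (s A v))
    = tmap (fun A => @teval L M x (fun B v => a B (r B v)) A) s by [].
  by apply: tuple_ext => A v; rewrite /tmap teval_rename.
- by rewrite !teval_rename.
- by rewrite IHp IHq.
- by rewrite IHp IHq.
- suff E b : (fun B0 v => tcons b a (rlift r v)) =
      tcons (x := x) b (fun B v => a B (r B v)) :> points M (B :: x).
    by split=> -[b]; [move/IHp; rewrite E|rewrite -E => /IHp]; exists b.
  by apply: tuple_ext; apply: var_consP.
Qed.

Lemma tcat_inl (F : sort L -> Type) x y (a : tuple_over F x)
  (b : tuple_over F y) A (v : var x A) : tcat a b (vinl y v) = a A v.
Proof.
elim: x a A v => [|B x IH] a A v; first by case: (var_nil v).
by move: A v; apply: var_consP => [|A v] //=; rewrite IH.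
Qed.

Lemma tcat_inr (F : sort L -> Type) x y (a : tuple_over F x)
  (b : tuple_over F y) A (v : var y A) : tcat a b (vinr x v) = b A v.
Proof. by elim: x a => [|B x IH] a //=; rewrite IH. Qed.

Lemma tcatP x y (P : forall A, var (x ++ y) A -> Prop) :
  (forall A (v : var x A), P A (vinl y v)) ->
  (forall A (v : var y A), P A (vinr x v)) -> forall A v, P A v.
Proof.
elim: x P => [|B x IH] P Pl Pr; first exact: Pr.
apply: var_consP; first exact: (Pl _ vz).
apply: (IH (fun A v => P A (vs v))) => A v; first exact: (Pl _ (vs v)).
exact: Pr.
Qed.

Lemma tcat_comp (F : sort L -> Type) x y z (a : tuple_over F z)
    (r : renaming x z) (s : renaming y z) :
  (fun A v => a A (tcat r s v)) =
  tcat (fun A v => a A (r A v)) (fun A v => a A (s A v)).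
Proof.
by apply: tuple_ext; apply: tcatP => A v; rewrite ?tcat_inl ?tcat_inr.
Qed.

Lemma tmap_cat (F F' : sort L -> Type) (f : forall A, F A -> F' A) x y
    (a : tuple_over F x) (b : tuple_over F y) :
  tmap f (tcat a b) = tcat (tmap f a) (tmap f b).
Proof.
apply: tuple_ext; apply: tcatP => A v;
  by rewrite /tmap ?tcat_inl ?tcat_inr.
Qed.

Lemma tcat_surj (F : sort L -> Type) x y (a : tuple_over F (x ++ y)) :
  a = tcat (fun A v => a A (vinl y v)) (fun A v => a A (vinr x v)).
Proof.
by apply: tuple_ext; apply: tcatP => A v; rewrite ?tcat_inl ?tcat_inr.
Qed.

Lemma sat_iso M N (i : iso M N) x (phi : formula x) (a : points M x) :
  sat phi a <-> sat phi (tmap i a).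
Proof.
have te x' (b : points M x') A (t : term x' A) :
    i A (teval b t) = teval (tmap i b) t.
  elim: t => [B v|f s IH] //=; rewrite iso_fint; congr fint.
  by apply: tuple_ext => B v; apply: IH.
elim: phi a => {x}
  [x|x|x R s|x A s t|x p IHp q IHq|x p IHp q IHq|x B p IHp] a //=.
- rewrite (iso_rint i); set u := tmap _ _; set w := tmap _ _.
  suff -> : u = w by [].
  by apply: tuple_ext => A v; apply: te.
- by rewrite -!te; split=> [->|/(bij_inj (iso_bij i A))].
- by rewrite IHp IHq.
- by rewrite IHp IHq.
- have E b : tmap i (tcons b a) = tcons (i B b) (tmap i a).
    by apply: tuple_ext; apply: var_consP.
  split=> [[b /IHp]|[c]]; first by rewrite E; exists (i B b).
  have [g _ gK] := iso_bij i B; rewrite -(gK c) -E => /IHp.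
  by exists (g c).
Qed.

End Substitution.

Section SpecTopology.
Context (L : language) (T : theory L) (K : Type).
Implicit Types (x y : context L) (mu : labelled_model T K).

Lemma labels_at_cat mu x y (k : params K x) (l : params K y)
    (a : points mu x) (b : points mu y) :
  labels_at mu k a -> labels_at mu l b -> labels_at mu (tcat k l) (tcat a b).
Proof.
by move=> ka lb; apply: tcatP => A v; rewrite ?tcat_inl ?tcat_inr.
Qed.

Lemma labels_at_catP mu x y (k : params K x) (l : params K y)
    (a : points mu (x ++ y)) : labels_at mu (tcat k l) a ->
  exists b c, [/\ labels_at mu k b, labels_at mu l c & a = tcat b c].
Proof.
move=> H; exists (fun A v => a A (vinl y v)), (fun A v => a A (vinr x v)).
split; last exact: tcat_surj.
  by move=> A v; rewrite -H tcat_inl.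
by move=> A v; rewrite -H tcat_inr.
Qed.

Lemma labels_at_fun mu x (k : params K x) (a b : points mu x) :
  labels_at mu k a -> labels_at mu k b -> a = b.
Proof.
by move=> ka kb; apply: tuple_ext => A v; have := ka A v; rewrite kb => -[].
Qed.

Lemma labels_at_ex mu x (a : points mu x) : exists k, labels_at mu k a.
Proof.
have H A (v : var x A) : {k | lab mu A k = Some (a A v)}.
  by apply: cid; have /infinite_setN0 := lab_infinite mu (a A v).
by exists (fun A v => projT1 (H A v)) => A v; case: (H A v).
Qed.

Lemma spec_base_cover : \bigcup_(U in @spec_base L T K) U = setT.
Proof.
apply/seteqP; split=> // mu _; exists setT => //.
exists [::], ftrue, (@tnil _ _); apply/seteqP; split=> // nu _.
by exists (@tnil _ _) => // A v; case: (var_nil v).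
Qed.

Lemma spec_base_join (U V : set (labelled_model T K)) mu :
  spec_base U -> spec_base V -> U mu -> V mu ->
  exists W, [/\ spec_base W, W mu & W `<=` U `&` V].
Proof.
move=> [x [phi [k ->]]] [y [psi [l ->]]] [a ka sa] [b lb sb].
pose r : renaming x (x ++ y) := fun A v => vinl y v.
pose s : renaming y (x ++ y) := fun A v => vinr x v.
exists (spec_basic (fand (frename phi r) (frename psi s)) (tcat k l)); split.
- by eexists _, _, _.
- exists (tcat a b); first exact: labels_at_cat.
  rewrite /= !sat_rename; split.
    by rewrite (_ : (fun _ _ => _) = a)//; apply: tuple_ext => A v;
       rewrite tcat_inl.
  by rewrite (_ : (fun _ _ => _) = b)//; apply: tuple_ext => A v;
     rewrite tcat_inr.
- move=> nu [c /labels_at_catP [a' [b' [ka' lb' ->]]]] /=.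
  rewrite !sat_rename => -[sa' sb']; split.
    exists a' => //; move: sa'.
    by rewrite (_ : (fun _ _ => _) = a')//; apply: tuple_ext => A v;
       rewrite tcat_inl.
  exists b' => //; move: sb'.
  by rewrite (_ : (fun _ _ => _) = b')//; apply: tuple_ext => A v;
     rewrite tcat_inr.
Qed.

(* Bases and subbases are sets of sets, indexed by themselves through [id]. *)
HB.instance Definition _ := gen_eqMixin (labelled_model T K).
HB.instance Definition _ := gen_choiceMixin (labelled_model T K).
HB.instance Definition _ := isBaseTopological.Build (labelled_model T K)
  (b := id) spec_base_cover
  (fun U V mu (bU : spec_base U) (bV : spec_base V) => spec_base_join bU bV).

HB.instance Definition _ := gen_eqMixin (arrow T K).
HB.instance Definition _ := gen_choiceMixin (arrow T K).
HB.instance Definition _ :=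
  isSubBaseTopological.Build (arrow T K) (@arrow_subbase L T K) id.

End SpecTopology.

(* Every point has an open neighbourhood U that f maps homeomorphically onto an
   open set, with inverse g. *)
Definition local_homeomorphism (E B : topologicalType) (f : E -> B) : Prop :=
  forall p, exists (U : set E) (g : B -> E),
    [/\ open U, U p & open (f @` U)] /\
    [/\ {within U, continuous f}, {within f @` U, continuous g} &
        forall q, U q -> g (f q) = q].

(* M_1 x_{dom, M_0} E *)
Definition pullback L (T : theory L) K (E : Type)
    (p : E -> labelled_model T K) : set (arrow T K * E) :=
  [set q | dom q.1 = p q.2].

Definition in_pullback L (T : theory L) K (E : Type)
    (p : E -> labelled_model T K) (al : arrow T K) (e : E)
    (h : dom al = p e) : pullback p :=
  exist _ (al, e) (mem_set h).

Record equivariant_sheaf L (T : theory L) (K : Type) := EquivariantSheaf {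
  es_space :> topologicalType;
  es_proj : es_space -> labelled_model T K;
  es_act : pullback es_proj -> es_space;
  es_etale : local_homeomorphism es_proj;
  es_act_continuous : continuous es_act;
  es_act_cod : forall al e (h : dom al = es_proj e),
    es_proj (es_act (in_pullback h)) = cod al;
  es_act_id : forall mu e (h : dom (arrow_id mu) = es_proj e),
    es_act (in_pullback h) = e;
  es_act_comp : forall (mu nu xi : labelled_model T K) (al : iso nu xi) (be : iso mu nu) e
    (h : dom (Arrow be) = es_proj e)
    (h' : dom (Arrow al) = es_proj (es_act (in_pullback h)))
    (h'' : dom (Arrow (iso_comp al be)) = es_proj e),
    es_act (in_pullback h'') = es_act (in_pullback h')
}.

Definition equivariant_subsheaf L (T : theory L) K (F : equivariant_sheaf T K)
    (S : set F) : Prop :=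
  open S /\
  forall (al : arrow T K) (e : F) (h : dom al = es_proj e),
    S e -> S (es_act (in_pullback h)).

Record sem_point L (T : theory L) (K : Type) (x : context L) := SemPoint {
  sem_base : labelled_model T K;
  sem_elt : points sem_base x
}.

(* W_{phi(x,l)} *)
Definition sem_basic L (T : theory L) K (x y : context L)
    (phi : formula (x ++ y)) (l : params K y) : set (sem_point T K x) :=
  [set p | exists2 b : points (sem_base p) y,
     labels_at (sem_base p) l b & sat phi (tcat (sem_elt p) b)].

Definition sem_opens L (T : theory L) K (x : context L) :
    set_system (sem_point T K x) :=
  [set U | exists (y : context L) (phi : formula (x ++ y)) (l : params K y),
     U = sem_basic phi l].

Section SemSheaf.
Context (L : language) (T : theory L) (K : Type) (x : context L).
Local Notation M0 := (labelled_model T K).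
Local Notation M1 := (arrow T K).
Local Notation E := (sem_point T K x).

Lemma sem_cover : \bigcup_(U in @sem_opens L T K x) U = setT.
Proof.
apply/seteqP; split=> // p _; exists setT => //.
exists [::], ftrue, (@tnil _ _); apply/seteqP; split=> // q _.
by exists (@tnil _ _) => // A v; case: (var_nil v).
Qed.

Lemma sem_join (U V : set E) p :
  sem_opens U -> sem_opens V -> U p -> V p ->
  exists W, [/\ sem_opens W, W p & W `<=` U `&` V].
Proof.
move=> [y [phi [k ->]]] [z [psi [l ->]]] [a ka sa] [b lb sb].
pose r : renaming (x ++ y) (x ++ (y ++ z)) :=
  tcat (fun A v => vinl (y ++ z) v) (fun A v => vinr x (vinl z v)).
pose s : renaming (x ++ z) (x ++ (y ++ z)) :=
  tcat (fun A v => vinl (y ++ z) v) (fun A v => vinr x (vinr y v)).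
have Er (F : sort L -> Type) (c : tuple_over F x) (d : tuple_over F y)
  (e : tuple_over F z) :
    (fun A v => tcat c (tcat d e) (r A v)) = tcat c d.
  rewrite /r tcat_comp; congr tcat; apply: tuple_ext => A v;
  by rewrite ?tcat_inl ?tcat_inr ?tcat_inl.
have Es (F : sort L -> Type) (c : tuple_over F x) (d : tuple_over F y)
  (e : tuple_over F z) :
    (fun A v => tcat c (tcat d e) (s A v)) = tcat c e.
  rewrite /s tcat_comp; congr tcat; apply: tuple_ext => A v;
  by rewrite ?tcat_inl ?tcat_inr ?tcat_inr.
exists (sem_basic (fand (frename phi r) (frename psi s)) (tcat k l)); split.
- by eexists _, _, _.
- exists (tcat a b); first exact: labels_at_cat.
  by rewrite /= !sat_rename Er Es.
- move=> q [c /labels_at_catP [a' [b' [ka' lb' ->]]]] /=.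
  by rewrite !sat_rename Er Es => -[sa' sb']; split; [exists a'|exists b'].
Qed.

HB.instance Definition _ := gen_eqMixin E.
HB.instance Definition _ := gen_choiceMixin E.
HB.instance Definition _ := isBaseTopological.Build E (b := id) sem_cover
  (fun U V p (bU : sem_opens U) (bV : sem_opens V) => sem_join bU bV).

(* rho_al <mu, a> = <nu, al(a)>; a is transported along dom al = mu. *)
Definition sem_act (q : pullback (@sem_base L T K x)) : E :=
  let al := (val q).1 in
  SemPoint (tmap al
    (eq_rect_r (fun mu : M0 => points mu x) (sem_elt (val q).2)
               (set_mem (valP q)))).

Lemma sem_actE (mu nu : M0) (al : iso mu nu) (a : points mu x)
  (h : dom (Arrow al) = sem_base (SemPoint a)) :
  sem_act (in_pullback h) = SemPoint (tmap al a).
Proof.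
rewrite /sem_act /=; move: (set_mem _) => /= e.
by rewrite (Prop_irrelevance e erefl).
Qed.

Lemma spec_basic_open y (phi : formula y) (k : params K y) :
  open (spec_basic phi k : set M0).
Proof.
exists [set spec_basic phi k]; last by rewrite bigcup_set1.
by move=> _ ->; exists y, phi, k.
Qed.

Lemma sem_basic_open y (phi : formula (x ++ y)) (l : params K y) :
  open (sem_basic phi l : set E).
Proof.
exists [set sem_basic phi l]; last by rewrite bigcup_set1.
by move=> _ ->; exists y, phi, l.
Qed.

Lemma spec_open_basic (U : set M0) mu : open U -> U mu ->
  exists y (phi : formula y) (k : params K y),
    spec_basic phi k mu /\ spec_basic phi k `<=` U.
Proof.
move=> [D sD <-] [V DV Vmu]; have [y [phi [k VE]]] := sD _ DV.
by exists y, phi, k; rewrite -VE; split=> // nu Vnu; exists V.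
Qed.

Lemma sem_open_basic (U : set E) p : open U -> U p ->
  exists y (phi : formula (x ++ y)) (l : params K y),
    sem_basic phi l p /\ sem_basic phi l `<=` U.
Proof.
move=> [D sD <-] [V DV Vp]; have [y [phi [k VE]]] := sD _ DV.
by exists y, phi, k; rewrite -VE; split=> // q Vq; exists V.
Qed.

Lemma spec_nbhs (U : set M0) mu : nbhs mu U ->
  exists y (phi : formula y) (k : params K y),
    spec_basic phi k mu /\ spec_basic phi k `<=` U.
Proof.
rewrite nbhsE => -[V [oV Vmu] VU].
have [y [phi [k [Wmu WV]]]] := spec_open_basic oV Vmu.
by exists y, phi, k; split=> //; apply: subset_trans VU.
Qed.

Lemma sem_nbhs (U : set E) p : nbhs p U ->
  exists y (phi : formula (x ++ y)) (l : params K y),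
    sem_basic phi l p /\ sem_basic phi l `<=` U.
Proof.
rewrite nbhsE => -[V [oV Vp] VU].
have [y [phi [k [Wp WV]]]] := sem_open_basic oV Vp.
by exists y, phi, k; split=> //; apply: subset_trans VU.
Qed.

Lemma sem_base_continuous : continuous (@sem_base L T K x).
Proof.
move=> p U /spec_nbhs [y [phi [k [[b kb sb] VU]]]].
pose r : renaming y (x ++ y) := fun A v => vinr x v.
have E (mu : M0) (a : points mu x) (c : points mu y) :
    (fun A v => tcat a c (r A v)) = c.
  by apply: tuple_ext => A v; rewrite tcat_inr.
rewrite nbhs_filterE /= nbhsE.
exists (sem_basic (frename phi r) k).
  split; first exact: sem_basic_open.
  by exists b => //; rewrite sat_rename E.
move=> q [c kc]; rewrite sat_rename E => sc.
by apply: VU; exists c.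
Qed.

Fixpoint all_eq (w z : context L) : renaming w z -> renaming w z -> formula z :=
  match w return renaming w z -> renaming w z -> formula z with
  | [::] => fun _ _ => ftrue
  | B :: w' => fun r s =>
      fand (feq (tvar (r _ vz)) (tvar (s _ vz)))
           (all_eq (fun A v => r A (vs v)) (fun A v => s A (vs v)))
  end.

Lemma sat_all_eq (M : structure L) w z (r s : renaming w z) (a : points M z) :
  sat (all_eq r s) a <-> forall A v, a A (r A v) = a A (s A v).
Proof.
elim: w r s => [|B w IH] r s /=.
  by split=> // _ A v; case: (var_nil v).
rewrite IH; split=> [[e1 e2]|e]; last by split=> *; apply: e.
exact: var_consP.
Qed.

Definition section_formula : formula (x ++ x) :=
  all_eq (fun A v => vinl x v) (fun A v => vinr x v).

Lemma section_formulaP (k : params K x) (p : E) :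
  sem_basic section_formula k p <-> labels_at (sem_base p) k (sem_elt p).
Proof.
split=> [[b kb /sat_all_eq e]|kp].
  suff -> : sem_elt p = b by [].
  by apply: tuple_ext => A v; have := e A v; rewrite tcat_inl tcat_inr.
exists (sem_elt p) => //; apply/sat_all_eq => A v.
by rewrite tcat_inl tcat_inr.
Qed.

Lemma sem_etale : local_homeomorphism (@sem_base L T K x).
Proof.
move=> p; have [k kp] := labels_at_ex (sem_elt p).
pose g (mu : M0) : E :=
  if pselect (exists a : points mu x, labels_at mu k a) is left h
  then SemPoint (projT1 (cid h)) else p.
have gE (mu : M0) (a : points mu x) : labels_at mu k a -> g mu = SemPoint a.
  move=> ka; rewrite /g; case: pselect => [h|]; last by case; exists a.
  by congr SemPoint; case: (cid h) => b kb; apply: labels_at_fun kb ka.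
have imE : @sem_base L T K x @` sem_basic section_formula k
    = spec_basic (@ftrue L x) k.
  apply/seteqP; split=> [_ [q /section_formulaP kq <-]|mu [a ka _]].
    by exists (sem_elt q).
  by exists (SemPoint a) => //; apply/section_formulaP.
exists (sem_basic section_formula k), g; split.
  split; [exact: sem_basic_open|exact/section_formulaP|].
  by rewrite imE; apply: spec_basic_open.
split.
- by apply: continuous_subspaceT; apply: sem_base_continuous.
- rewrite imE; apply/subspace_continuousP => mu [a ka _] U gU.
  have : nbhs (g mu) U by []; rewrite (gE _ _ ka) => /sem_nbhs [y [phi [l [[b lb sb] WU]]]].
  rewrite nbhs_filterE /= /within /= nbhsE.
  exists (spec_basic phi (tcat k l)).
    split; first exact: spec_basic_open.
    by exists (tcat a b) => //; apply: labels_at_cat.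
  move=> nu [c /labels_at_catP [a' [b' [ka' lb' ->]]] sc] _.
  by change (U (g nu)); rewrite (gE _ _ ka'); apply: WU; exists b'.
- by move=> [mu a] /section_formulaP; apply: gE.
Qed.

Lemma sem_act_continuous : continuous sem_act.
Proof.
move=> q U qU; have {qU} : nbhs (sem_act q) U by []; case: q => -[[mu nu al] [mu' a]] qP.
have /= h : mu = mu' := set_mem qP; case: mu' / h a qP => a qP.
have -> : exist _ (Arrow al, SemPoint a) qP =
    in_pullback (p := @sem_base L T K x) (al := Arrow al) (e := SemPoint a) erefl.
  by congr exist; apply: Prop_irrelevance.
rewrite sem_actE => /sem_nbhs [y [phi [l [[b lb sb] WU]]]].
have [c cb] : exists c : points mu y, tmap al c = b.
  have H A : exists h, cancel h (al A).
    by have [h _ hK] := iso_bij al A; exists h.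
  exists (fun A v => projT1 (cid (H A)) (b A v)); apply: tuple_ext => A v.
  by rewrite /tmap; case: (cid (H A)) => h hK /=.
have [k kc] := labels_at_ex c.
rewrite nbhs_filterE /=.
have : nbhs (Arrow al, SemPoint a : E) (arrow_basic k l `*` sem_basic phi k).
  exists (arrow_basic k l, sem_basic phi k) => //=; split.
    apply: open_nbhs_nbhs; split; last by exists c, b.
    exists [set arrow_basic k l]; last by rewrite bigcup_set1.
    move=> _ ->; apply: (@finI_from1 _ _ _ id); apply: Or33.
    by exists y, k, l.
  apply: open_nbhs_nbhs; split; first exact: sem_basic_open.
  exists c => //; apply/(sat_iso al); by rewrite tmap_cat cb.
set q0 := in_pullback _ => H.
have {}H := @initial_continuous (set_type (pullback (@sem_base L T K x)))
  (M1 * E)%type set_val q0 _ H.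
rewrite set_valE in H.
apply: (@filterS _ (nbhs q0) (nbhs_filter q0) _ _ _ H) => {H}.
move=> [[[mu1 nu1 be] [mu2 d]] qP'] /=.
have h : mu1 = mu2 := set_mem qP'; case: mu2 / h d qP' => d qP'.
move=> [[c' [b' [/= kc' lb' cb']]] [/= c'' kc'' sc]]; apply: WU.
have -> : exist _ (Arrow be, SemPoint d) qP' =
    in_pullback (p := @sem_base L T K x) (al := Arrow be) (e := SemPoint d) erefl.
  by congr exist; apply: Prop_irrelevance.
rewrite sem_actE; exists b' => //=.
by rewrite -cb' -tmap_cat -sat_iso (labels_at_fun kc' kc'').
Qed.

Lemma sem_act_cod (al : M1) (e : E) (h : dom al = sem_base e) :
  sem_base (sem_act (in_pullback h)) = cod al.
Proof. by []. Qed.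

Lemma sem_act_id mu (e : E) (h : dom (arrow_id mu) = sem_base e) :
  sem_act (in_pullback h) = e.
Proof. by case: e h => nu a /= h; case: nu / h a => a; rewrite sem_actE. Qed.

Lemma sem_act_comp (mu nu xi : M0) (al : iso nu xi) (be : iso mu nu) (e : E)
    (h : dom (Arrow be) = sem_base e)
    (h' : dom (Arrow al) = sem_base (sem_act (in_pullback h)))
    (h'' : dom (Arrow (iso_comp al be)) = sem_base e) :
  sem_act (in_pullback h'') = sem_act (in_pullback h').
Proof.
case: e h h'' h' => mu' a h.
change (mu = mu') in h; case: mu' / h a => a h''.
have E1 := sem_actE (al := be) (a := a) erefl.
set e1 := sem_act _ in E1 * => h'; case: _ / (esym E1) h' => h'.
by rewrite !sem_actE.
Qed.

(* [[A]], for x : A *)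
Definition sem_sheaf : equivariant_sheaf T K :=
  EquivariantSheaf sem_etale sem_act_continuous
    sem_act_cod sem_act_id sem_act_comp.

(* [[phi]] *)
Definition definable_subsheaf (phi : formula x) : set sem_sheaf :=
  [set p : E | sat phi (sem_elt p)].

End SemSheaf.

(* Main.v *)
Require Import Defs.
From mathcomp Require Import all_boot all_classical topology.

Set Implicit Arguments.
Unset Strict Implicit.
Unset Printing Implicit Defensive.

Local Open Scope classical_set_scope.

(** If [S] contains a point of a basic open set [W_{phi(x,l)}] included in [S],
    let [psi(x)] be [exists y, phi(x,y)], where variables of [y] carrying the same
    label in [l] are first identified.  Whenever [c] satisfies [psi] in [M_nu], the
    finitely many labels [l] can be reassigned to the witnesses without making any
    fibre finite.  The relabelled point lies in [W_{phi(x,l)}], and the identity of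
    [M_nu] is an arrow back to [nu], so [<nu, c>] is in [S] by equivariance. *)

Fixpoint fexs (L : language) (x y : context L) : formula (y ++ x) -> formula x :=
  match y return formula (y ++ x) -> formula x with
  | [::] => fun phi => phi
  | B :: y' => fun phi => fexs (fex phi)
  end.

Lemma sat_fexs (L : language) (M : structure L) (x y : context L)
    (phi : formula (y ++ x)) (a : points M x) :
  sat (fexs phi) a <-> exists d : points M y, sat phi (tcat d a).
Proof.
elim: y phi => [|B y IH] phi /=.
  by split=> [|[]//]; exists (@tnil _ _).
rewrite IH; split=> [[d [b sb]]|[d sd]]; first by exists (tcons b d).
by exists (fun A v => d A (vs v)), (d B vz).
Qed.

Lemma finite_params (L : language) (K : Type) (y : context L) (l : params K y)
    (A : Defs.sort L) : finite_set (range (l A)).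
Proof.
elim: y l => [|B y IH] l.
  by apply: (@sub_finite_set _ _ set0) => // k [v]; case: (var_nil v).
pose l' : params K y := fun A v => l A (vs v).
apply: (@sub_finite_set _ _ ([set l B vz] `|` range (l' A))).
  move=> _ [v _ <-]; move: A v {IH}.
  by apply: var_consP => [|A v]; [left|right; exists v].
by rewrite finite_setU; split; [exact: finite_set1|exact: IH].
Qed.

Section Relabel.
Context (L : language) (T : theory L) (K : Type) (y : context L).
Context (l : params K y).

(** The choice depends on [v] only through its label: by proof irrelevance, positions of one sort
    with the same label get the same representative. *)
Definition label_repr : renaming y y :=
  fun A v => projT1 (cid (ex_intro (fun w => l w = l v) v erefl)).

Lemma label_reprK A (v : var y A) : l (label_repr v) = l v.
Proof. by rewrite /label_repr; case: cid. Qed.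

Lemma labels_at_repr (mu : labelled_model T K) (b : points mu y) A (v : var y A) :
  labels_at mu l b -> b A (label_repr v) = b A v.
Proof. by move=> lb; apply: Some_inj; rewrite -!lb label_reprK. Qed.

Context (mu : labelled_model T K) (d : points mu y).

Definition relabel_lab A (k : K) : option (carrier mu A) :=
  if pselect (exists v : var y A, l v = k) is left h then Some (d (projT1 (cid h)))
  else lab mu A k.

(** The new fibre over [a] contains the old one minus the finite range of [l A]. *)
Lemma relabel_infinite A (a : carrier mu A) :
  infinite_set [set k | relabel_lab A k = Some a].
Proof.
have H := infinite_setD (lab_infinite mu a) (finite_params l A).
apply: sub_infinite_set H => k [/= ka nk].
rewrite /relabel_lab; case: pselect => // -[v kv].
by case: nk; exists v.
Qed.

Definition relabel : labelled_model T K := LabelledModel relabel_infinite.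

Lemma labels_at_relabel :
  labels_at relabel l (fun A v => d (label_repr v)).
Proof.
move=> A v; rewrite /= /relabel_lab; case: pselect => [h|[]]; last by exists v.
(* [h] and the proof inside [label_repr] inhabit the same proposition, so both choices pick the same
   position. *)
by rewrite (Prop_irrelevance h (ex_intro _ v erefl)).
Qed.

End Relabel.

Section SemProjection.
Context (L : language) (T : theory L) (K : Type) (x y : context L).
Context (phi : formula (x ++ y)) (l : params K y).

(** [fexs] binds a prefix, hence [y] moves in front of [x]. Positions that are not representatives
    are quantified vacuously; even with empty sorts this is harmless, as each shares its sort with
    its representative. *)
Definition sem_proj : formula x :=
  fexs (frename phi (tcat (fun A v => vinr y v)
                          (fun A v => vinl x (label_repr l v)))).

Lemma sat_sem_proj (M : structure L) (a : points M x) :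
  sat sem_proj a <->
  exists d : points M y, sat phi (tcat a (fun A v => d A (label_repr l v))).
Proof.
rewrite sat_fexs.
have E (d : points M y) :
    (fun A (v : var (x ++ y) A) =>
       tcat d a (tcat (fun A v => vinr y v)
                      (fun A v => vinl x (label_repr l v)) v)) =
    tcat a (fun A v => d A (label_repr l v)).
  by rewrite tcat_comp; congr tcat; apply: tuple_ext => A v;
     rewrite ?tcat_inl ?tcat_inr.
by split=> -[d sd]; exists d; move: sd; rewrite sat_rename E.
Qed.

Lemma sem_basic_sub_proj :
  sem_basic phi l `<=` (definable_subsheaf sem_proj : set (sem_sheaf T K x)).
Proof.
move=> p [b lb sb]; apply/sat_sem_proj; exists b.
suff -> : (fun A v => b A (label_repr l v)) = b by [].
by apply: tuple_ext => A v; apply: labels_at_repr lb.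
Qed.

Lemma sem_proj_sub (S : set (sem_sheaf T K x)) : equivariant_subsheaf S ->
  sem_basic phi l `<=` S -> definable_subsheaf sem_proj `<=` S.
Proof.
move=> [_ actS] WS [nu c] /sat_sem_proj [d sd].
pose nu' := relabel l d.
(* This typechecks because [nu'] and [nu] have convertible underlying models. *)
pose al : iso nu' nu := iso_id nu.
have Snu' : S (SemPoint (sem_base := nu') c).
  apply: WS; exists (fun A v => d A (label_repr l v)) => //.
  exact: labels_at_relabel.
have := actS (Arrow al) (SemPoint (sem_base := nu') c) erefl Snu'.
by rewrite /= sem_actE.
Qed.

End SemProjection.

Theorem lemma1p5p4 (L : language) (T : theory L) (K : Type)
    (hK : has_card_kappa L K) (x : context L) (S : set (sem_sheaf T K x)) :
  equivariant_subsheaf S ->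
  exists Phi : set (formula x),
    S = \bigcup_(phi in Phi) definable_subsheaf phi.
Proof.
(* With all formulas whose definable subsheaf lies in [S], one inclusion is immediate; it remains to
   cover each point of [S]. *)
move=> eqS; exists [set phi | definable_subsheaf phi `<=` S].
apply/seteqP; split=> [p Sp|p [phi phiS /phiS]//].
have [y [phi [l [Wp WS]]]] := sem_open_basic eqS.1 Sp.
exists (sem_proj phi l); first exact: sem_proj_sub eqS WS.
exact: sem_basic_sub_proj Wp.
Qed.
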